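(* Let $(T_1,T_2)$ be a commuting contractive pair which has a strongly minimal And\^o lift. Then any minimal And\^o lift of $(T_1,T_2)$ is strongly minimal and, consequently, any two minimal And\^o lifts of $(T_1,T_2)$ are unitarily equivalent.
   Context: Commuting contractive pair: commuting operators of norm at most $1$ on a Hilbert space $\mathcal H$. And\^o lift of $(T_1,T_2)$: $(\Pi,V_1,V_2)$ with $\Pi:\mathcal H\to\mathcal K$ isometric and commuting isometries $V_1,V_2$ on $\mathcal K$ with $V_j^*\Pi=\Pi T_j^*$. It is minimal if $\mathcal K=\bigvee_{n_1,n_2\ge0}V_1^{n_1}V_2^{n_2}\operatorname{Ran}\Pi$, and strongly minimal if $\mathcal K=\bigvee_{n\ge0}V_1^nV_2^n\operatorname{Ran}\Pi$. Two And\^o lifts $(\Pi,V_1,V_2)$ on $\mathcal K$ and $(\Pi',V_1',V_2')$ on $\mathcal K'$ are unitarily equivalent if there is a unitary $\tau:\mathcal K\to\mathcal K'$ with $\tau\Pi=\Pi'$ and $\tau V_j=V_j'\tau$, $j=1,2$. *)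

(* Defs.v *)
From HB Require Import structures.
From mathcomp Require Import all_boot all_order all_algebra sesquilinear.
From mathcomp Require Import complex.
From mathcomp Require Import all_classical all_reals all_analysis.

Set Implicit Arguments.
Unset Strict Implicit.
Unset Printing Implicit Defensive.

Import Order.TTheory GRing.Theory Num.Theory.
Import numFieldNormedType.Exports.

Local Open Scope classical_set_scope.
Local Open Scope ring_scope.

(** Complex Hilbert spaces.  The inner product is linear in its first argument;
    norms are [R[i]]-valued, as for every [normedModType R[i]]. *)
HB.mixin Record isHilbert (R : realType) V of CompleteNormedModule R[i] V := {
  inner : {dot V for (@Num.conj R[i])} ;
  sqr_norm_inner : forall x : V, `|x| ^+ 2 = inner x x
}.

#[short(type="hilbertType")]
HB.structure Definition Hilbert (R : realType) :=
  { V of isHilbert R V & CompleteNormedModule R[i] V }.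

Section Operators.
Variable R : realType.
Implicit Types H K : hilbertType R.

Definition contraction H K (T : {linear H -> K}) :=
  forall x : H, `|T x| <= `|x|.

Definition isometric H K (V : {linear H -> K}) :=
  forall x : H, `|V x| = `|x|.

Definition unitary H K (U : {linear H -> K}) :=
  isometric U /\ (forall y : K, exists x : H, U x = y).

Definition commuting H (T1 T2 : {linear H -> H}) :=
  forall x : H, T1 (T2 x) = T2 (T1 x).

(** The Hilbert-space adjoint: [adjoint T y] is the vector [z], unique if it
    exists, with [<T x, y> = <x, z>] for all [x].  By the Riesz representation
    theorem it exists whenever [T] is bounded, which is the only case of
    interest; the default value 0 is then never used. *)
Definition adjoint H K (T : {linear H -> K}) (y : K) : H :=
  xget 0 [set z : H | forall x : H, inner (T x) y = inner x z].

(** The smallest closed linear subspace containing [A]. *)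
Definition closed_span H (A : set H) : set H :=
  smallest [set S : set H | submod_closed [in S] /\ closed S] A.

Definition commuting_contractive_pair H (T1 T2 : {linear H -> H}) :=
  [/\ contraction T1, contraction T2 & commuting T1 T2].

Definition ando_lift H (T1 T2 : {linear H -> H})
    K (Pi : {linear H -> K}) (V1 V2 : {linear K -> K}) :=
  [/\ isometric Pi, isometric V1 /\ isometric V2, commuting V1 V2,
      (forall h : H, adjoint V1 (Pi h) = Pi (adjoint T1 h)) &
      (forall h : H, adjoint V2 (Pi h) = Pi (adjoint T2 h))].

Definition minimal_lift H K (Pi : {linear H -> K}) (V1 V2 : {linear K -> K}) :=
  closed_span [set k : K | exists n1 n2 (h : H),
    k = iter n1 V1 (iter n2 V2 (Pi h))] = [set: K].

Definition strongly_minimal_lift H K (Pi : {linear H -> K})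
    (V1 V2 : {linear K -> K}) :=
  closed_span [set k : K | exists n (h : H),
    k = iter n V1 (iter n V2 (Pi h))] = [set: K].

Definition unitarily_equivalent H K (Pi : {linear H -> K})
    (V1 V2 : {linear K -> K})
    K' (Pi' : {linear H -> K'}) (V1' V2' : {linear K' -> K'}) :=
  exists tau : {linear K -> K'},
    [/\ unitary tau, (forall h : H, tau (Pi h) = Pi' h),
        (forall k : K, tau (V1 k) = V1' (tau k)) &
        (forall k : K, tau (V2 k) = V2' (tau k))].

End Operators.

(* Main.v *)
(** For an Andô lift, the inner product of [V1^a V2^b Pi h] and [V1^c V2^d Pi g]
    depends only on [T1] and [T2] as soon as the exponents are comparable
    componentwise, because isometries cancel and [Vj^* Pi = Pi Tj^*].  The
    vectors [V1^n V2^n Pi h] together with their images under one of the [Vj]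
    have comparable exponents.  Hence a strongly minimal lift embeds
    isometrically into any other lift by a map that intertwines [V1] and [V2];
    the closed range of this map is the whole space when the target is
    minimal, so the map is then unitary and transports strong minimality. *)
From HB Require Import structures.
Require Import Defs.
From mathcomp Require Import all_boot all_order all_algebra.
From mathcomp Require Import sesquilinear complex.
From mathcomp Require Import all_classical all_reals all_analysis.
From mathcomp Require Import ring lra zify.
Set Implicit Arguments.
Unset Strict Implicit.
Unset Printing Implicit Defensive.
Import Order.TTheory GRing.Theory Num.Theory numFieldNormedType.Exports.
Local Open Scope classical_set_scope.
Local Open Scope ring_scope.

(** Pythagoras for the component of [u] orthogonal to [v]. It yields Cauchy-Schwarz by positivity,
    and later the orthogonality of a vector of minimal norm. *)
Lemma dnorm_sub_proj (C : numClosedFieldType) (U : lmodType C)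
    (f : {dot U for (@Num.conj C)}) (u v : U) : v != 0 ->
  f (u - (f u v / f v v) *: v) (u - (f u v / f v v) *: v)
    = f u u - `|f u v| ^+ 2 / f v v.
Proof.
move=> v0; have fv0 : 0 < f v v by rewrite dnorm_gt0.
have fvR : (f v v)^* = f v v by apply/CrealP/ger0_real/ltW.
rewrite dnormB dnormZ linearZr_LR/= !rmorphM/= conjCK fmorphV/= fvR.
rewrite !normCK rmorphM/= fmorphV/= fvR.
by field; rewrite gt_eqF.
Qed.

Lemma dot_cauchy_schwarz (C : numClosedFieldType) (U : lmodType C)
    (f : {dot U for (@Num.conj C)}) (u v : U) :
  `|f u v| ^+ 2 <= f u u * f v v.
Proof.
have [->|v0] := eqVneq v 0.
  by rewrite (linear0r f) normr0 (linear0r f) mulr0 expr0n.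
rewrite -ler_pdivrMr ?dnorm_gt0// -subr_ge0 -dnorm_sub_proj//.
Qed.

(** * Continuity, isometries and closed graphs in Hilbert spaces *)

Section Hilbert.
Variable (R : realType).
Implicit Types H K : hilbertType R.

Lemma innerC H (x y : H) : inner y x = (inner x y)^*.
Proof. by rewrite hermC/= expr0 mul1r. Qed.

Lemma norm_inner_le H (x y : H) : `|inner x y| <= `|x| * `|y|.
Proof.
rewrite -(@ler_pXn2r _ 2)// ?nnegrE ?mulr_ge0//.
by rewrite exprMn !sqr_norm_inner dot_cauchy_schwarz.
Qed.

Lemma near_dist_lt (V : normedModType R[i]) (x : V) (e : R[i]) : 0 < e ->
  \forall z \near x, `|x - z| < e.
Proof.
move=> e0; have := nbhsx_ballx x e e0.
by apply: filterS => z; rewrite -ball_normE.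
Qed.

Lemma inner_continuous H (y : H) : continuous (fun x : H => inner x y).
Proof.
move=> x; apply/cvgrPdist_lt => e e0.
have d0 : 0 < e / (`|y| + 1) by rewrite divr_gt0// ltr_wpDl.
near=> z.
rewrite -linearBl (le_lt_trans (norm_inner_le _ _))//.
have : `|x - z| < e / (`|y| + 1).
  by near: z; exact: near_dist_lt.
rewrite ltr_pdivlMr ?ltr_wpDl//; apply: le_lt_trans.
by rewrite ler_wpM2l// lerDl.
Unshelve. all: by end_near. Qed.

Lemma closed_equalizer (T : topologicalType) (V : normedModType R[i])
  (f g : T -> V) : continuous f -> continuous g -> closed [set x | f x = g x].
Proof.
move=> cf cg.
have -> : [set x | f x = g x] = (fun x => f x - g x) @^-1` [set 0].
  by apply/seteqP; split=> x /=; [move=> ->; rewrite subrr|move/subr0_eq].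
apply: preimage_closed; last first.
  by apply/accessible_closed_set1/hausdorff_accessible; exact: norm_hausdorff.
by move=> x _; apply: cvgB; [exact: cf|exact: cg].
Qed.

Lemma contraction_continuous H K (T : {linear H -> K}) :
  Defs.contraction T -> continuous T.
Proof.
move=> cT x; apply/cvgrPdist_lt => e e0; near=> z.
rewrite -linearB (le_lt_trans (cT _))//.
Unshelve. all: by end_near. Qed.

Lemma isometric_contraction H K (V : {linear H -> K}) :
  isometric V -> Defs.contraction V.
Proof. by move=> iV x; rewrite iV. Qed.

Lemma isometric_continuous H K (V : {linear H -> K}) :
  isometric V -> continuous V.
Proof. by move=> /isometric_contraction/contraction_continuous. Qed.

(** First coordinates converging to [x] form a Cauchy filter, hence so do their partners, as
    distances agree. Completeness of [K] gives the partners a limit, and closedness of [G] puts the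
    limiting pair in [G]. *)
Lemma isometric_graph_proj_closed H K (G : set (H * K)) : closed G ->
  (forall p q, G p -> G q -> `|p.1 - q.1| = `|p.2 - q.2|) ->
  closed [set x | exists y, G (x, y)].
Proof.
move=> clG isoG x; set D := [set x | _] => Dx.
pose t (u : H) : K := xget 0 [set y | G (u, y)].
have tG u : D u -> G (u, t u).
  by move=> Du; exact: (@xgetPex _ 0 [set y | G (u, y)]).
have PF : ProperFilter (within D (nbhs x)) by exact: within_nbhs_proper.
have : cauchy (t u @[u --> within D (nbhs x)]).
  apply: cauchy_exP => e e0.
  have e20 : 0 < e / 2 by rewrite divr_gt0.
  have nx : nbhs x (ball x (e / 2)) by exact: nbhsx_ballx.
  have [u [Du xu]] := Dx _ nx.
  exists (t u); rewrite /fmap/= /within/=.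
  apply: filterS nx => v xv Dv.
  rewrite -ball_normE/=.
  have <- := isoG _ _ (tG _ Du) (tG _ Dv).
  rewrite /= [e]splitr (le_lt_trans (ler_distD x _ _))// ltrD//.
    by rewrite distrC; move: xu; rewrite -ball_normE.
  by move: xv; rewrite -ball_normE.
move=> /cauchy_cvg/cvg_ex[y ty].
exists y.
apply: (@closed_cvg _ _ (within D (nbhs x)) _ (fun u => (u, t u)) G) => //.
- by apply: filterS (withinT D _) => u; exact: tG.
- by apply: cvg_pair => //; exact: cvg_within.
Qed.

(** Polarization: expanding the norm of [V (u + v)] shows that the defect [g] has zero real part
    everywhere; replacing [x] by ['i *: x] kills its imaginary part too. *)
Lemma inner_isometric H K (V : {linear H -> K}) (x y : H) :
  isometric V -> inner (V x) (V y) = inner x y.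
Proof.
move=> iV; pose g (x y : H) := inner (V x) (V y) - inner x y.
have gN (u v : H) : g u v + (g u v)^* = 0.
  have := iV (u + v) => /(congr1 (fun r => r ^+ 2)).
  rewrite !sqr_norm_inner linearD !dnormD -!sqr_norm_inner !iV => /addrI gE.
  by rewrite rmorphB/= addrACA gE -opprD subrr.
have giZ : g ('i *: x) y = 'i * g x y.
  by rewrite /g linearZ/= !linearZl_LR/= mulrBr.
have := gN ('i *: x) y; rewrite giZ rmorphM/= conjCi mulNr -mulrBr => /eqP.
rewrite mulf_eq0 (negPf (neq0Ci _))/= subr_eq0 => /eqP gC.
have /eqP := gN x y; rewrite -gC -mulr2n -mulr_natl mulf_eq0 pnatr_eq0/=.
by rewrite subr_eq0 => /eqP.
Qed.

Lemma isometric_range_closed H K (V : {linear H -> K}) :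
  isometric V -> closed (range V).
Proof.
move=> iV.
(* The range is the projection of the transposed graph, which is closed because [V] is
   continuous. *)
have -> : range V = [set y | exists x, [set p : K * H | p.1 = V p.2] (y, x)].
  apply/seteqP; split=> y /=; first by case=> x _ <-; exists x.
  by case=> x ->; exists x.
apply: isometric_graph_proj_closed.
  apply: closed_equalizer; first by move=> p; exact: cvg_fst.
  move=> p; apply: continuous_comp; first exact: cvg_snd.
  exact: isometric_continuous.
by move=> p q /= -> ->; rewrite -linearB iV.
Qed.

(** * Closed linear spans and isometries defined on spanning families *)

Lemma submod_closed_setP (V : lmodType R[i]) (S : set V) :
  submod_closed [in S] <->
  S 0 /\ (forall a u v, S u -> S v -> S (a *: u + v)).
Proof.
split=> [] [S0 SP]; split; rewrite ?inE in S0 * => //.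
- by move=> a u v Su Sv; have := SP a u v; rewrite !inE; apply.
- by move=> a u v; rewrite !inE; exact: SP.
Qed.

(** Stated for normed modules so that it also covers the product [H * K], which carries no inner
    product here. *)
Lemma smallest_closed_subspace (V : normedModType R[i]) (A : set V)
    (closed_subspace := fun S : set V => submod_closed [in S] /\ closed S) :
  closed_subspace (smallest closed_subspace A).
Proof.
split; last by apply: closed_bigI => S [[_ ?] _].
apply/submod_closed_setP; split=> [S [[/submod_closed_setP[]]]//|].
move=> a u v Gu Gv S SA; have [[/submod_closed_setP[_ SP] _] _] := SA.
by apply: SP; [exact: Gu|exact: Gv].
Qed.

Lemma closed_span_setT_sub H (A S : set H) : closed_span A = [set: H] ->
  submod_closed [in S] -> closed S -> A `<=` S -> S = [set: H].
Proof.
move=> spA lS cS AS; apply/seteqP; split=> // x _.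
have : closed_span A x by rewrite spA.
by apply: smallest_sub.
Qed.

Lemma closed_span_mono K (A B : set K) : closed_span A = [set: K] ->
  A `<=` B -> closed_span B = [set: K].
Proof.
have [lB cB] := smallest_closed_subspace B.
move=> spA AB; apply: (closed_span_setT_sub spA) => //.
by apply: subset_trans AB _; exact: sub_gen_smallest.
Qed.

Lemma isometric_eq_on K K' (f g : {linear K -> K'}) (A : set K) :
  isometric f -> isometric g -> closed_span A = [set: K] ->
  (forall x, A x -> f x = g x) -> forall x, f x = g x.
Proof.
move=> fi gi spA fg x.
suff E : [set x | f x = g x] = [set: K] by have : [set: K] x by []; rewrite -E.
apply: (closed_span_setT_sub spA) => //.
- apply/submod_closed_setP; split; first by rewrite /= !linear0.
  by move=> a u v /= uE vE; rewrite !linearP uE vE.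
- by apply: closed_equalizer; exact: isometric_continuous.
Qed.

(* The closed span of the pairs [(f i, g i)] in [H * K] is the graph of [tau]. *)
Lemma gram_isometry (I : Type) H K (f : I -> H) (g : I -> K) :
  (forall i j, inner (f i) (f j) = inner (g i) (g j)) ->
  closed_span (range f) = [set: H] ->
  exists2 tau : {linear H -> K}, isometric tau & forall i, tau (f i) = g i.
Proof.
move=> fg spf.
pose closed_subspace (S : set (H * K)) := submod_closed [in S] /\ closed S.
pose fgs : set (H * K) := range (fun i => (f i, g i)).
pose G := smallest closed_subspace fgs.
have fgG i : G (f i, g i) by apply: sub_gen_smallest; exists i.
have [/submod_closed_setP[G0 GP] Gcl] : closed_subspace G.
  exact: smallest_closed_subspace.
(* For fixed [x] and [y], the pairs satisfying the conclusion form a closed subspace. Using this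
   once in each variable extends the Gram identity from the generators to all of [G]. *)
have Gmin x y : (forall i, inner (f i) x = inner (g i) y) ->
    forall p, G p -> inner p.1 x = inner p.2 y.
  move=> fxy; apply: smallest_sub; last by move=> _ [i _ <-]; exact: fxy.
  split.
    apply/submod_closed_setP; split; first by rewrite /= !linear0l.
    by move=> a u v /= uE vE; rewrite !linearPl /= uE vE.
  apply: (@closed_equalizer _ R[i]^o (fun p => inner p.1 x)
    (fun p => inner p.2 y)) => p.
    by apply: (@continuous_comp _ _ _ fst (fun u => inner u x));
      [exact: cvg_fst|exact: inner_continuous].
  by apply: (@continuous_comp _ _ _ snd (fun u => inner u y));
    [exact: cvg_snd|exact: inner_continuous].
have Ginner p q : G p -> G q -> inner p.1 q.1 = inner p.2 q.2.
  move=> Gp Gq; apply: (Gmin _ _ _ _ Gp) => i.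
  rewrite innerC [RHS]innerC; congr (_^*).
  by apply: (Gmin _ _ _ _ Gq) => j; exact: fg.
have Gnorm p : G p -> `|p.1| = `|p.2|.
  move=> Gp; apply/eqP; rewrite -(@eqrXn2 _ 2)//.
  by rewrite !sqr_norm_inner Ginner.
have GB p q : G p -> G q -> G (p - q).
  by move=> Gp Gq; rewrite addrC -scaleN1r; exact: GP.
(* The domain of [G] is closed because [G] preserves norms, and it contains the spanning family; so
   the default 0 in [t] below is never taken. *)
have GE : [set x | exists y, G (x, y)] = [set: H].
  apply: (closed_span_setT_sub spf).
  - apply/submod_closed_setP; split; first by exists 0.
    move=> a u v [u' Gu] [v' Gv]; exists (a *: u' + v').
    exact: (GP a _ _ Gu Gv).
  - apply: isometric_graph_proj_closed => // p q Gp Gq.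
    exact: Gnorm (GB _ _ Gp Gq).
  - by move=> _ [i _ <-]; exists (g i).
have Gex x : exists y, G (x, y) by have : [set: H] x by []; rewrite -GE.
have Guniq x y z : G (x, y) -> G (x, z) -> y = z.
  move=> Gy Gz; have /= := Gnorm _ (GB _ _ Gy Gz).
  by rewrite subrr normr0 => /esym/normr0_eq0/subr0_eq.
pose t x := xget 0 [set y | G (x, y)].
have tG x : G (x, t x).
  exact: (@xgetPex _ (0 : K) [set y | G (x, y)] (Gex x)).
have tlin : linear t.
  move=> a u v; apply: (Guniq (a *: u + v)) => //.
  exact: (GP a _ _ (tG u) (tG v)).
pose tauM := GRing.isLinear.Build _ _ _ _ t tlin.
pose tau : {linear H -> K} := HB.pack t tauM.
exists tau.
  by move=> x; rewrite -(Gnorm _ (tG x)).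
by move=> i; apply: (Guniq (f i)); [exact: tG|exact: fgG].
Qed.

(** * Riesz representation and adjoints *)

(** The norm as a real number: infima and arithmetic with inequalities are carried out in the
    totally ordered field [R]. *)
Definition nrm H (x : H) : R := complex.Re `|x|.

Lemma nrmE H (x : H) : (nrm x)%:C%C = `|x|.
Proof. exact/RRe_real/normr_real. Qed.

Lemma nrm_ge0 H (x : H) : 0 <= nrm x.
Proof. by rewrite -lecR nrmE normr_ge0. Qed.

Lemma nrmD H (x y : H) : nrm (x + y) <= nrm x + nrm y.
Proof. by rewrite -lecR rmorphD/= !nrmE ler_normD. Qed.

Lemma nrm_parallelogram H (x y : H) :
  nrm (x - y) ^+ 2 + nrm (x + y) ^+ 2 = 2 * (nrm x ^+ 2 + nrm y ^+ 2).
Proof.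
apply: (@complexI R); rewrite !(rmorphD, rmorphM, rmorphXn)/= !nrmE.
rewrite -!expr2 !sqr_norm_inner dnormB dnormD rmorph1.
ring.
Qed.

Lemma nrm_ball H (x y : H) (e : R[i]) : 0 < e ->
  ball x e y <-> nrm (x - y) < complex.Re e.
Proof.
move=> e0; rewrite -ball_normE/= -ltcR nrmE RRe_real//.
exact: gtr0_real.
Qed.

(* The elements of nearly minimal norm form a Cauchy filter by the
   parallelogram law. *)
Lemma min_norm_exists H (S : set H) : S !=set0 -> closed S ->
  (forall x y, S x -> S y -> S (2^-1 *: (x + y))) ->
  exists2 w, S w & forall x, S x -> nrm w <= nrm x.
Proof.
move=> [s0 Ss0] clS cvxS.
pose E := [set nrm x | x in S]; pose d := inf E.
have lbE : has_lbound E by exists 0 => _ [x _ <-]; exact: nrm_ge0.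
have infE : has_inf E by split; first by exists (nrm s0), s0.
have dle x : S x -> d <= nrm x by move=> Sx; apply: ge_inf => //; exists x.
have d0 : 0 <= d by apply: lb_le_inf infE.1 _ => _ [x _ <-]; exact: nrm_ge0.
pose B e := [set x | S x /\ nrm x < d + e].
pose F := filter_from [set e : R | 0 < e] B.
have BS e f : e <= f -> B e `<=` B f.
  by move=> ef x [Sx xe]; split=> //; apply: lt_le_trans xe _; rewrite lerD2l.
have FF : Filter F.
  apply: filter_from_filter; first by exists 1 => /=.
  move=> e f e0 f0; exists (Num.min e f); first by rewrite /= lt_min e0 f0.
  by rewrite subsetI; split; apply: BS; rewrite ge_min lexx ?orbT.
have BN e : 0 < e -> B e !=set0.
  by move=> e0; have [_ [x Sx <-] xe] := inf_adherent e0 infE; exists x.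
have PF : ProperFilter F by exact: filter_from_proper.
have : cauchy F.
  apply: cauchy_exP => r r0.
  have r0' : 0 < complex.Re r by rewrite -ltcR RRe_real// gtr0_real.
  (* If [x] and [y] have norm below [d + e] and their midpoint has norm at least [d], the
     parallelogram law bounds the square of [nrm (x - y)] by [4 (d + e)^2 - 4 d^2 = 4 e (2 d + e)],
     which is at most [q^2] since [e <= 1]. *)
  pose q := complex.Re r; pose e := Num.min 1 (q ^+ 2 / (4 * (2 * d + 1))).
  have D0 : 0 < 4 * (2 * d + 1) by rewrite mulr_gt0// ltr_wpDl// mulr_ge0.
  have e0 : 0 < e by rewrite lt_min ltr01/= divr_gt0// exprn_gt0.
  have e1 : e <= 1 by rewrite ge_min lexx.
  have eq : e * (4 * (2 * d + 1)) <= q ^+ 2.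
    by rewrite -ler_pdivlMr// ge_min lexx orbT.
  have [x [Sx xe]] := BN _ e0.
  exists x, e => // y [Sy ye]; apply/nrm_ball => //.
  have xy : 2 * d <= nrm (x + y).
    have := dle _ (cvxS _ _ Sx Sy).
    have -> : nrm (2^-1 *: (x + y)) = 2^-1 * nrm (x + y).
      apply: (@complexI R); rewrite rmorphM/= !nrmE normrZ.
      by rewrite ger0_norm ?invr_ge0// fmorphV rmorph_nat.
    lra.
  have := nrm_parallelogram x y; have := nrm_ge0 (x - y).
  have := nrm_ge0 x; have := nrm_ge0 y; rewrite -/q.
  move: (nrm (x - y)) (nrm (x + y)) (nrm x) (nrm y) xy xe ye r0' => a b u v.
  rewrite -/q => xy xe ye q0 v0 u0 a0 P.
  rewrite -(@ltr_pXn2r _ 2)// ?nnegrE//; last exact: ltW.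
  have b2 : (2 * d) ^+ 2 <= b ^+ 2 by rewrite ler_pXn2r ?nnegrE//; lra.
  have u2 : u ^+ 2 < (d + e) ^+ 2 by rewrite ltr_pXn2r ?nnegrE//; lra.
  have v2 : v ^+ 2 < (d + e) ^+ 2 by rewrite ltr_pXn2r ?nnegrE//; lra.
  nra.
move=> /cauchy_cvg/cvg_ex[w Fw].
have Sw : S w.
  apply: (@closed_cvg _ _ F _ id S) => //.
  by exists 1 => //= x [].
(* Every ball around [w] contains elements of [S] of norm arbitrarily close to [d], so
   [nrm w <= d]. *)
exists w => // x /dle; apply: le_trans; apply/ler_addgt0Pr => e e0.
have e20 : 0 < e / 2 by rewrite divr_gt0.
have [f f0 fB] : F (ball w (e / 2)%:C%C).
  by apply: Fw; apply: nbhsx_ballx; rewrite ltcR.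
have [y [Sy ye]] := BN (Num.min f (e / 2)) ltac:(by rewrite lt_min f0 e20).
have /nrm_ball : ball w (e / 2)%:C%C y.
  by apply: fB; apply: BS (conj Sy ye); rewrite ge_min lexx.
rewrite ltcR => /(_ e20)/= wy.
have := nrmD (w - y) y; rewrite subrK.
have : nrm y < d + e / 2.
  by apply: lt_le_trans ye _; rewrite lerD2l ge_min lexx orbT.
lra.
Qed.

(** Subtracting from [w] its projection onto [y] lowers the squared norm by [|<w, y>|^2 / <y, y>],
    so minimality forces this to vanish. *)
Lemma min_norm_orthogonal H (w y : H) :
  (forall c, nrm w <= nrm (w - c *: y)) -> inner w y = 0.
Proof.
move=> wmin; have [->|y0] := eqVneq y 0; first by rewrite (linear0r inner).
have := wmin (inner w y / inner y y).
rewrite -lecR !nrmE -(@ler_pXn2r _ 2)// ?nnegrE// !sqr_norm_inner.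
rewrite dnorm_sub_proj// lerBrDr gerDl ler_pdivrMr ?dnorm_gt0// mul0r.
by rewrite real_exprn_even_le0//= ?normr_real// normr_eq0 => /eqP.
Qed.

(** The vector [w] of minimal norm in the hyperplane [phi = 1] is orthogonal to the kernel of [phi],
    and [w / <w, w>] represents [phi]. An empty hyperplane means [phi = 0]. *)
Lemma riesz_representation H (phi : {linear H -> R[i]^o}) :
  continuous phi -> exists z, forall x, phi x = inner x z.
Proof.
move=> cphi; pose S := [set x | phi x = 1].
have [S0|NS0] := pselect (S !=set0); last first.
  exists 0 => x; rewrite linear0r; apply/eqP/negPn/negP => x0.
  apply: NS0; exists ((phi x)^-1 *: x).
  by rewrite /S/= linearZ/= /GRing.scale/= mulVf.
have clS : closed S by apply: closed_equalizer => //; exact: cst_continuous.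
have [w phw wmin] : exists2 w, phi w = 1 & forall x, S x -> nrm w <= nrm x.
  apply: min_norm_exists => // x y; rewrite /S/= => x1 y1.
  by rewrite linearZ/= linearD/= x1 y1 /GRing.scale/= mulVf.
have w0 : inner w w != 0.
  rewrite dnorm_eq0; apply/eqP => w0; move: phw.
  by rewrite w0 linear0 => /esym/eqP; rewrite oner_eq0.
exists ((inner w w)^-1 *: w) => x.
have : inner w (x - phi x *: w) = 0.
  apply: min_norm_orthogonal => c; apply: wmin.
  have phi0 : phi (x - phi x *: w) = 0.
    by rewrite linearB linearZ/= phw [_ *: _]mulr1 subrr.
  by rewrite /S/= linearB linearZ/= phi0 scaler0 subr0.
rewrite linearBr linearZr_LR/= => /subr0_eq/(congr1 (fun z => z^*)).
rewrite -innerC rmorphM/= conjCK -innerC => xw.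
by rewrite linearZr_LR/= xw fmorphV/= -innerC mulrC mulfK.
Qed.

(** Riesz representation supplies the vector sought by [adjoint], so its default value is not taken
    for a contraction. *)
Lemma adjointP H K (T : {linear H -> K}) (x : H) (y : K) :
  Defs.contraction T -> inner (T x) y = inner x (adjoint T y).
Proof.
move=> cT; pose phi (x : H) : R[i]^o := inner (T x) y.
have lphi : linear phi by move=> a u v; rewrite /phi linearP/= linearPl.
pose phM := GRing.isLinear.Build _ _ _ _ phi lphi.
pose ph : {linear H -> R[i]^o} := HB.pack phi phM.
have ex : exists z, forall x, inner (T x) y = inner x z.
  have := @riesz_representation _ ph; apply=> u.
  apply: (@continuous_comp _ _ _ T (fun v => inner v y)).
    exact: contraction_continuous.
  exact: inner_continuous.
exact: (@xgetPex _ (0 : H) [set z | forall x, inner (T x) y = inner x z]).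
Qed.

(** * Gram matrices of Andô lifts *)

Section AndoLift.
Variables (H : hilbertType R) (T1 T2 : {linear H -> H}).

Lemma lift_adjoint K (Pi : {linear H -> K}) (V : {linear K -> K})
    (T : {linear H -> H}) n (x : K) (g : H) : isometric V ->
  (forall h, adjoint V (Pi h) = Pi (adjoint T h)) ->
  inner (iter n V x) (Pi g) = inner x (Pi (iter n (adjoint T) g)).
Proof.
move=> /isometric_contraction cV VT; elim: n g => // n IH g.
by rewrite iterS adjointP// VT IH -iterSr.
Qed.

Lemma iter_isometric_inner K (V : {linear K -> K}) n (x y : K) :
  isometric V -> inner (iter n V x) (iter n V y) = inner x y.
Proof. by move=> iV; elim: n => //= n IH; rewrite inner_isometric. Qed.

Lemma iter_commuting K (V1 V2 : {linear K -> K}) a b (x : K) :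
  commuting V1 V2 -> iter a V1 (iter b V2 x) = iter b V2 (iter a V1 x).
Proof.
move=> cV; elim: b x => // b IH x.
rewrite !iterS -IH; elim: a {IH} => //= a IH.
by rewrite IH cV.
Qed.

(** The common powers [c] and [d] cancel by isometry; the surplus powers [a] and [b] move to the
    right as adjoints and pass through [Pi]. The resulting value no longer mentions the lift. *)
Lemma ando_gram_ge K (Pi : {linear H -> K}) (V1 V2 : {linear K -> K})
    a b c d (h g : H) : ando_lift T1 T2 Pi V1 V2 ->
  inner (iter (c + a) V1 (iter (d + b) V2 (Pi h)))
        (iter c V1 (iter d V2 (Pi g)))
  = inner h (iter b (adjoint T2) (iter a (adjoint T1) g)).
Proof.
move=> [iP [iV1 iV2] cV VT1 VT2].
rewrite iterD iter_isometric_inner// (iter_commuting _ _ _ cV).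
rewrite iterD iter_isometric_inner// -(iter_commuting _ _ _ cV).
by rewrite (lift_adjoint _ _ _ iV1 VT1) (lift_adjoint _ _ _ iV2 VT2)
  inner_isometric.
Qed.

Lemma ando_gram K (Pi : {linear H -> K}) (V1 V2 : {linear K -> K})
    K' (Pi' : {linear H -> K'}) (V1' V2' : {linear K' -> K'})
    a b c d (h g : H) :
  ando_lift T1 T2 Pi V1 V2 -> ando_lift T1 T2 Pi' V1' V2' ->
  (c <= a)%N && (d <= b)%N || (a <= c)%N && (b <= d)%N ->
  inner (iter a V1 (iter b V2 (Pi h))) (iter c V1 (iter d V2 (Pi g))) =
  inner (iter a V1' (iter b V2' (Pi' h))) (iter c V1' (iter d V2' (Pi' g))).
Proof.
move=> L L' /orP[] /andP[/subnKC <- /subnKC <-].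
  by rewrite !(ando_gram_ge _ _ _ _ _ _ L) !(ando_gram_ge _ _ _ _ _ _ L').
by rewrite innerC (ando_gram_ge _ _ _ _ _ _ L) [RHS]innerC
  (ando_gram_ge _ _ _ _ _ _ L').
Qed.

(** * Intertwining isometries between lifts *)

Section Intertwiner.
Variables (K K' : hilbertType R).
Variables (Pi : {linear H -> K}) (V1 V2 : {linear K -> K}).
Variables (Pi' : {linear H -> K'}) (V1' V2' : {linear K' -> K'}).
Hypotheses (L : ando_lift T1 T2 Pi V1 V2) (L' : ando_lift T1 T2 Pi' V1' V2').

(* The Gram matrix is only determined by [T1] and [T2] on families of exponents
   [(a, b)] that form a chain: [inner (V1 (Pi h)) (V2 (Pi g))] is not. *)
Lemma chain_isometry (I : Type) (a b : I -> nat) (h : I -> H) :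
  (forall i j, (a j <= a i)%N && (b j <= b i)%N
            || (a i <= a j)%N && (b i <= b j)%N) ->
  strongly_minimal_lift Pi V1 V2 ->
  (forall n g, exists i, [/\ a i = n, b i = n & h i = g]) ->
  exists2 tau : {linear K -> K'}, isometric tau &
    forall i, tau (iter (a i) V1 (iter (b i) V2 (Pi (h i))))
            = iter (a i) V1' (iter (b i) V2' (Pi' (h i))).
Proof.
move=> ab smin diag; apply: gram_isometry => [i j|].
  exact: ando_gram.
apply: closed_span_mono smin _ => _ [n [g ->]].
by have [i [<- bi <-]] := diag n g; exists i => //; rewrite bi.
Qed.

Lemma strongly_minimal_intertwiner : strongly_minimal_lift Pi V1 V2 ->
  exists tau : {linear K -> K'}, [/\ isometric tau,
    (forall h, tau (Pi h) = Pi' h), (forall k, tau (V1 k) = V1' (tau k)) &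
    (forall k, tau (V2 k) = V2' (tau k))].
Proof.
move=> smin; have [_ [iV1 iV2] cV _ _] := L; have [_ [iV1' iV2'] cV' _ _] := L'.
(* The exponents [(n, n)] and [(n + 1, n)] together form a chain, and so do
   [(n, n)] and [(n, n + 1)]; the two isometries agree on [(n, n)], so they
   coincide and intertwine both [V1] and [V2]. *)
have diag n (g : H) : exists i : bool * nat * H,
    [/\ (i.1.2 + i.1.1)%N = n, i.1.2 = n & i.2 = g].
  by exists (false, n, g); rewrite /= addn0.
(* The boolean of an index counts as 0 or 1 and is the surplus power of [V1] for [tau], of [V2] for
   [sig]. *)
have [||tau itau tauE] := @chain_isometry (bool * nat * H)
    (fun i => i.1.2 + i.1.1)%N (fun i => i.1.2) snd _ smin.
- by move=> [[[] m] ?] [[[] n] ?] /=; lia.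
- exact: diag.
have [||sig isig sigE] := @chain_isometry (bool * nat * H)
    (fun i => i.1.2) (fun i => i.1.2 + i.1.1)%N snd _ smin.
- by move=> [[[] m] ?] [[[] n] ?] /=; lia.
- by move=> n g; have [i [? ? ?]] := diag n g; exists i.
have tauD n g :
    tau (iter n V1 (iter n V2 (Pi g))) = iter n V1' (iter n V2' (Pi' g)).
  by have := tauE (false, n, g); rewrite /= addn0.
have sigD n g :
    sig (iter n V1 (iter n V2 (Pi g))) = iter n V1' (iter n V2' (Pi' g)).
  by have := sigE (false, n, g); rewrite /= addn0.
have sig_tau : forall k, sig k = tau k.
  apply: (isometric_eq_on isig itau smin) => _ [n [g ->]].
  by rewrite tauD sigD.
exists tau; split=> //.
- by move=> g; exact: (tauD 0 g).
- apply: (@isometric_eq_on _ _ (tau \o V1) (V1' \o tau) _ _ _ smin).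
  + by move=> x /=; rewrite itau iV1.
  + by move=> x /=; rewrite iV1' itau.
  + move=> _ [n [g ->]] /=; rewrite tauD.
    by have := tauE (true, n, g); rewrite /= addn1.
(* Only [sig] is known on the exponents [(n, n + 1)], so the claim for [V2] is proved for it. *)
- move=> k; rewrite -!sig_tau; move: k.
  apply: (@isometric_eq_on _ _ (sig \o V2) (V2' \o sig) _ _ _ smin).
  + by move=> x /=; rewrite isig iV2.
  + by move=> x /=; rewrite iV2' isig.
  + move=> _ [n [g ->]] /=; rewrite sigD.
    (* The surplus [V2] stands inside [V1^n] here and must be commuted to the outside. *)
    have := sigE (true, n, g); rewrite /= addn1 /=.
    by rewrite (iter_commuting n 1 _ cV) (iter_commuting n 1 _ cV').
Qed.

Lemma intertwiner_unitary (tau : {linear K -> K'}) :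
  minimal_lift Pi' V1' V2' -> isometric tau ->
  (forall h, tau (Pi h) = Pi' h) -> (forall k, tau (V1 k) = V1' (tau k)) ->
  (forall k, tau (V2 k) = V2' (tau k)) -> unitary tau.
Proof.
move=> mn itau tPi tV1 tV2; split=> // y.
suff E : range tau = [set: K'].
  by have : [set: K'] y by []; rewrite -E => -[x _ <-]; exists x.
apply: (closed_span_setT_sub mn).
- apply/submod_closed_setP; split; first by exists 0; rewrite ?linear0.
  by move=> a _ _ [u _ <-] [v _ <-]; exists (a *: u + v); rewrite ?linearP.
- exact: isometric_range_closed.
- move=> _ [a [b [h ->]]]; exists (iter a V1 (iter b V2 (Pi h))) => //.
  elim: a => [|a IH]; last by rewrite /= tV1 IH.
  by elim: b => [|b IH]; [exact: tPi|rewrite /= tV2 IH].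
Qed.

End Intertwiner.
End AndoLift.
End Hilbert.

(** * Transport of strong minimality and uniqueness of minimal lifts *)

Theorem theorem6p4p2 (R : realType) (H : hilbertType R)
    (T1 T2 : {linear H -> H})
    (hT : commuting_contractive_pair T1 T2)
    (hstrong : exists (K : hilbertType R) (Pi : {linear H -> K})
        (V1 V2 : {linear K -> K}),
        ando_lift T1 T2 Pi V1 V2 /\ strongly_minimal_lift Pi V1 V2) :
  (forall (K : hilbertType R) (Pi : {linear H -> K})
      (V1 V2 : {linear K -> K}),
      ando_lift T1 T2 Pi V1 V2 -> minimal_lift Pi V1 V2 ->
      strongly_minimal_lift Pi V1 V2) /\
  (forall (K : hilbertType R) (Pi : {linear H -> K})
      (V1 V2 : {linear K -> K})
      (K' : hilbertType R) (Pi' : {linear H -> K'})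
      (V1' V2' : {linear K' -> K'}),
      ando_lift T1 T2 Pi V1 V2 -> minimal_lift Pi V1 V2 ->
      ando_lift T1 T2 Pi' V1' V2' -> minimal_lift Pi' V1' V2' ->
      unitarily_equivalent Pi V1 V2 Pi' V1' V2').
Proof.
have strong (K : hilbertType R) (Pi : {linear H -> K}) V1 V2 :
    ando_lift T1 T2 Pi V1 V2 ->
    minimal_lift Pi V1 V2 -> strongly_minimal_lift Pi V1 V2.
  move=> L mn; have [K0 [Pi0 [W1 [W2 [L0 smin0]]]]] := hstrong.
  have [tau [itau tPi tW1 tW2]] := strongly_minimal_intertwiner L0 L smin0.
  have [_ tau_onto] := intertwiner_unitary mn itau tPi tW1 tW2.
  rewrite /strongly_minimal_lift; set A := [set k | _].
  have [/submod_closed_setP[A0 AP] Acl] := smallest_closed_subspace A.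
  (* Pulling the span back along [tau] gives a closed subspace containing the diagonal generators of
     [K0]; surjectivity of [tau] then makes the span all of [K]. *)
  have E : tau @^-1` closed_span A = [set: K0].
    apply: (closed_span_setT_sub smin0).
    - apply/submod_closed_setP; split; first by rewrite /= linear0.
      by move=> a u v /= Au Av; rewrite linearP; exact: AP.
    - by apply: preimage_closed => // x _; exact: isometric_continuous.
    - move=> _ [n [h ->]]; apply: sub_gen_smallest; exists n, h.
      elim: {1 3}n => [|a IH]; last by rewrite /= tW1 IH.
      by elim: n => [|b IH]; [exact: tPi|rewrite /= tW2 IH].
  apply/seteqP; split=> // y _; have [x <-] := tau_onto y.
  by have : [set: K0] x by []; rewrite -E.
split=> // K Pi V1 V2 K' Pi' V1' V2' L mn L' mn'.
have smin := strong _ _ _ _ L mn.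
have [tau [itau tPi tV1 tV2]] := strongly_minimal_intertwiner L L' smin.
by exists tau; split=> //; exact: (intertwiner_unitary mn').
Qed.
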